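(* Let $D=(V,E)$ be a directed graph without loops, with vertex set $V=\{1,\ldots,n\}$ and at least one edge, and let $S\subseteq V$. Let $M$ be the incidence matrix of $D$ (rows indexed by vertices, columns by edges) and let $M(S)$ be the generalized incidence matrix for $D$ and $S$. Then the rows of $M(S)$ (i.e., the vertices) and the columns of $M$ (i.e., the edges) can be ordered so that the resulting matrix $M(S)$ (with the unit columns for $S$ placed first) is a sign-restricted matrix if and only if both of the following hold: (i) $D$ is acyclic; (ii) $d^-(v)-d^+(v)\le 1$ for every vertex $v$, and if $d^-(v)=d^+(v)+1$ for some vertex $v$ then $v\in S$.
   Context: A sign-restricted matrix (SRM) is a matrix $A=[a_{ij}]$ with entries in $\{0,1,-1\}$ such that every partial column sum $\sum_{k=1}^{i} a_{kj}$ equals $0$ or $1$, and every partial row sum $\sum_{l=1}^{j} a_{il}$ is nonnegative. The incidence matrix $M$ of $D$ has, in the column corresponding to the edge $(i,j)$, a $1$ in row $i$, a $-1$ in row $j$, and zeros elsewhere. The generalized incidence matrix $M(S)$ is obtained from $M$ by adjoining, before all columns of $M$, the distinct unit column vectors $e_v$ for $v\in S$ (a $1$ in row $v$, zeros elsewhere). $d^+(v)$ (resp. $d^-(v)$) is the number of edges of $D$ with tail (resp. head) $v$. *)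

(* Defs.v *)
From HB Require Import structures.
From mathcomp Require Import all_boot all_order all_algebra all_fingroup.

Set Implicit Arguments.
Unset Strict Implicit.
Unset Printing Implicit Defensive.

Import Order.TTheory GRing.Theory Num.Theory.
Local Open Scope ring_scope.

Definition sign_restricted (m n : nat) (A : 'M[int]_(m, n)) : Prop :=
  [/\ forall i j, A i j \in [:: 0; 1; -1],
      forall i j, \sum_(k < m | (k <= i)%N) A k j \in [:: 0; 1] &
      forall i j, 0 <= \sum_(l < n | (l <= j)%N) A i l].

(* A digraph on the vertex set 'I_n is given by its set E of edges; the edge *)
(* (u, v) has tail u and head v.                                             *)
Section Digraph.

Variables (n : nat) (E : {set 'I_n * 'I_n}).

Definition loopless : Prop := forall v : 'I_n, (v, v) \notin E.

Definition adj : rel 'I_n := fun u v => (u, v) \in E.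

(* ucycle only accepts sequences of pairwise distinct vertices, and also     *)
(* accepts the empty one, which is not a directed cycle.                     *)
Definition acyclic : Prop := forall c : seq 'I_n, ucycle adj c -> c = [::].

Definition outdeg (v : 'I_n) : nat := #|[set e in E | e.1 == v]|.
Definition indeg (v : 'I_n) : nat := #|[set e in E | e.2 == v]|.

Definition incidence_mx : 'M[int]_(n, #|E|) :=
  \matrix_(v < n, k < #|E|)
    (if v == (enum_val k).1 then 1
     else if v == (enum_val k).2 then -1 else 0).

End Digraph.

Definition unit_cols (n : nat) (S : {set 'I_n}) : 'M[int]_(n, #|S|) :=
  \matrix_(v < n, k < #|S|) (v == enum_val k)%:R.

(* M(S), for any matrix M with n rows. *)
Definition adjoin_units (n p : nat) (S : {set 'I_n}) (M : 'M[int]_(n, p)) :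
  'M[int]_(n, #|S| + p) := row_mx (unit_cols S) M.

(* Main.v *)
(* The column condition for the edge (u, v) says that u is placed above v, so   *)
(* the admissible vertex orders are the topological sorts of D. The last        *)
(* partial sum of row v is [v \in S] + d^+(v) - d^-(v), which gives (ii).       *)
(* Conversely, fix a topological sort and list the edges by decreasing position *)
(* of their tails: every edge leaving v then precedes every edge entering v, so *)
(* in each row all the 1s precede all the -1s, and the partial row sums are     *)
(* nonnegative as soon as the last one is.                                      *)
Require Import Defs.
From HB Require Import structures.
From mathcomp Require Import all_boot all_order all_algebra all_fingroup.
From mathcomp Require Import zify.

Set Implicit Arguments.
Unset Strict Implicit.

Import Order.TTheory GRing.Theory Num.Theory.
Local Open Scope ring_scope.

(** Acyclicity enters as the existence of a vertex rank strictly increasing along edges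
    ([acyclic_ranked], [acyclic_topological_rank]). [sorting_perm] turns ranks into row and edge
    orders, and [partial_sums_ge0] reduces the row condition to the totals of
    [sum_row_adjoin_units]. *)

Lemma sorting_perm (d : Order.disp_t) (T : orderType d) (n : nat) (f : 'I_n -> T) :
  exists s : 'S_n, forall i j, (f (s i) < f (s j))%O -> (i < j)%N.
Proof.
pose r : rel 'I_n := relpre f <=%O.
have sz : size (sort r (enum 'I_n)) == n by rewrite size_sort size_enum_ord.
have : perm_eq (Tuple sz) (ord_tuple n) by rewrite /= perm_sort.
case/tuple_permP=> s Es; exists s => i j; apply: contraTT; rewrite -leNgt -leqNgt => ji.
have nthE (k : 'I_n) : nth i (sort r (enum 'I_n)) k = s k.
  have -> : sort r (enum 'I_n) = [tuple tnth (ord_tuple n) (s l) | l < n] by rewrite -Es.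
  by rewrite -tnth_nth tnth_mktuple tnth_ord_tuple.
rewrite -(nthE i) -(nthE j).
have r_tr : transitive r by move=> x y z; apply: le_trans.
apply: (sorted_leq_nth r_tr (fun x => lexx (f x))) => //.
- by apply: sort_sorted => x y; apply: le_total.
- by rewrite inE (eqP sz).
- by rewrite inE (eqP sz).
Qed.

(** If a negative term occurs up to [j], all later terms are nonpositive, so the partial sum is at
    least the total; otherwise it has no negative term. *)
Lemma partial_sums_ge0 (R : realDomainType) (m : nat) (F : 'I_m -> R) :
    (forall k l, F k < 0 -> 0 < F l -> (l < k)%N) -> 0 <= \sum_l F l ->
  forall j : nat, 0 <= \sum_(l < m | (l <= j)%N) F l.
Proof.
move=> posneg tot j.
case: (boolP [exists k : 'I_m, (k <= j)%N && (F k < 0)]) => [/existsP|/existsPn noneg].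
  case=> k /andP[kj Fk]; apply: le_trans tot _.
  rewrite (bigID (fun l : 'I_m => (l <= j)%N)) /= gerDl; apply: sumr_le0 => l.
  rewrite -ltnNge leNgt => jl; apply/negP => /(posneg _ _ Fk) lk.
  by have := leq_ltn_trans kj (ltn_trans jl lk); rewrite ltnn.
apply: sumr_ge0 => l lj; rewrite leNgt.
by have := noneg l; rewrite lj.
Qed.

Section Acyclic.

Variables (n : nat) (E : {set 'I_n * 'I_n}).

(** Going once around a cycle through [x] would give [f x < f x]. *)
Lemma acyclic_ranked (f : 'I_n -> nat) :
  (forall e, e \in E -> (f e.1 < f e.2)%N) -> acyclic E.
Proof.
move=> fE [//|x p] /andP[cyc _].
have lt_path : path (relpre f ltn) x (rcons p x).
  by apply: sub_path cyc => u v /fE.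
have lt_tr : transitive (relpre f ltn) by move=> ? ? ?; apply: ltn_trans.
by have /allP/(_ x) := order_path_min lt_tr lt_path; rewrite mem_rcons mem_head /= ltnn => /(_ isT).
Qed.

(** The edge closes a path from [v] to [u] into a cycle; the path is shortened first because
    [ucycle] wants distinct vertices. *)
Lemma acyclic_edge_not_connect (u v : 'I_n) :
  acyclic E -> (u, v) \in E -> ~~ connect (adj E) v u.
Proof.
move=> acyc uvE; apply/connectP=> -[p vp Eu].
case/shortenP: vp Eu => p' vp' uniq_p' _ Eu.
have : ucycle (adj E) (v :: p').
  by rewrite /ucycle /= rcons_path vp' -Eu /adj uvE.
by move/acyc.
Qed.

(* The number of vertices from which v is reachable increases along edges. *)
Lemma acyclic_topological_rank :
  acyclic E -> exists f : 'I_n -> nat, forall e, e \in E -> (f e.1 < f e.2)%N.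
Proof.
move=> acyc; exists (fun v => #|[set w | connect (adj E) w v]|) => -[u v] /= uvE.
apply: proper_card; apply/properP; split.
  apply/subsetP=> w; rewrite !inE => /connect_trans; apply; exact: connect1.
(* [v] reaches itself but not [u], so the inclusion is strict. *)
by exists v; rewrite inE ?connect0 // acyclic_edge_not_connect.
Qed.

End Acyclic.

Section Incidence.

Variables (n : nat) (E : {set 'I_n * 'I_n}).
Hypothesis E_loopless : loopless E.

(** Without loops the two tests never both succeed, so the nested [if] is a difference of
    indicators, which can be summed termwise. *)
Lemma incidence_mxE (v : 'I_n) (k : 'I_#|E|) :
  incidence_mx E v k =
    (v == (enum_val k).1)%:R - (v == (enum_val k).2)%:R.
Proof.
rewrite mxE; have := enum_valP k; case: (enum_val k) => a b /= abE.
case: (eqVneq v a) => [va|_]; last by case: eqVneq => _; rewrite ?subr0 ?sub0r.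
case: (eqVneq v b) => [vb|_]; last by rewrite subr0.
by move: abE; rewrite -va -vb (negPf (E_loopless v)).
Qed.

Lemma sum_pred_eq (R : pzSemiRingType) (P : pred 'I_n) (a : 'I_n) :
  \sum_(w | P w) (w == a)%:R = (P a)%:R :> R.
Proof.
rewrite big_mkcond (bigD1 a) //= eqxx big1 ?addr0; first by case: (P a).
by move=> w /negPf ->; case: (P w).
Qed.

Lemma sum_col_incidence_mx (P : pred 'I_n) (k : 'I_#|E|) :
  \sum_(w | P w) incidence_mx E w k =
    (P (enum_val k).1)%:R - (P (enum_val k).2)%:R.
Proof.
under eq_bigr do rewrite incidence_mxE.
by rewrite sumrB !sum_pred_eq.
Qed.

Lemma sum_eq_enum_val (R : pzSemiRingType) (g : 'I_n * 'I_n -> 'I_n) (v : 'I_n) :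
  \sum_(k < #|E|) (v == g (enum_val k))%:R = #|[set e in E | g e == v]|%:R :> R.
Proof.
rewrite -(big_enum_val (fun e => (v == g e)%:R)) /= -natr_sum; congr _%:R.
rewrite -sum1_card big_mkcond [RHS]big_mkcond /=; apply: eq_bigr => e _.
by rewrite inE eq_sym; case: (e \in E); case: eqP.
Qed.

Lemma sum_row_incidence_mx (v : 'I_n) :
  \sum_k incidence_mx E v k = (outdeg E v)%:R - (indeg E v)%:R.
Proof.
under eq_bigr do rewrite incidence_mxE.
by rewrite sumrB (sum_eq_enum_val _ fst) (sum_eq_enum_val _ snd).
Qed.

Lemma sum_row_adjoin_units (S : {set 'I_n}) (t : 'S_#|E|) (v : 'I_n) :
  \sum_l adjoin_units S (col_perm t (incidence_mx E)) v l =
    (v \in S)%:R + ((outdeg E v)%:R - (indeg E v)%:R).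
Proof.
rewrite big_split_ord /=; congr (_ + _).
  under eq_bigr do rewrite row_mxEl mxE eq_sym.
  by rewrite -(big_enum_val (fun w : 'I_n => (w == v)%:R)) /= sum_pred_eq.
under eq_bigr do rewrite row_mxEr mxE.
by rewrite -sum_row_incidence_mx [RHS](reindex_inj (@perm_inj _ t)).
Qed.

(** Row [k] of the permuted matrix belongs to vertex [s k], so [s^-1 w] is the position of vertex
    [w]. *)
Lemma sum_perm_row (s : 'S_n) (i : nat) (F : 'I_n -> int) :
  \sum_(k < n | (k <= i)%N) F (s k) = \sum_(w | ((s^-1)%g w <= i)%N) F w.
Proof.
rewrite [RHS](reindex_inj (@perm_inj _ s)) /=.
by apply: eq_bigl => k; rewrite permK.
Qed.

End Incidence.

Theorem theorem2p5 (n : nat) (E : {set 'I_n * 'I_n}) (S : {set 'I_n})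
    (E_loopless : loopless E) (E_nonempty : E != set0) :
  (exists (s : 'S_n) (t : 'S_#|E|),
     sign_restricted
       (row_perm s (adjoin_units S (col_perm t (incidence_mx E)))))
  <->
  (acyclic E /\
   ((forall v : 'I_n, (indeg E v)%:Z - (outdeg E v)%:Z <= 1) /\
    (forall v : 'I_n, indeg E v = (outdeg E v + 1)%N -> v \in S))).
Proof.
split=> [[s [t [_ cols rows]]] | [acyc [deg_le degS]]].
- split.
    apply: (@acyclic_ranked _ _ (fun v => (s^-1)%g v)) => e eE.
    pose k := enum_rank_in eE e.
    have ek : enum_val k = e by apply: enum_rankK_in.
    (* In the column of [e], stop at the row of its head: the head contributes -1, so the tail must
       already have contributed 1. *)
    have := cols ((s^-1)%g e.2) (rshift #|S| ((t^-1)%g k)).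
    under eq_bigr do rewrite mxE row_mxEr mxE permKV.
    rewrite (sum_perm_row s _ (incidence_mx E ^~ k)) sum_col_incidence_mx //= ek leqnn.
    rewrite [(_ < _)%N]ltn_neqAle; case: leqP => //= _ _.
    rewrite andbT (inj_eq val_inj) (inj_eq perm_inj).
    (* Equal positions would make [e] a loop. *)
    apply/eqP=> e12; move: (E_loopless e.1).
    by rewrite {2}e12 -surjective_pairing eE.
  have tot v : 0 <= (v \in S)%:R + ((outdeg E v)%:R - (indeg E v)%:R) :> int.
    (* This bound exceeds every column index, so the partial sum is the whole row sum. *)
    have := rows ((s^-1)%g v) (#|S| + #|E|)%N.
    rewrite -(sum_row_adjoin_units E_loopless S t).
    under eq_bigr do rewrite mxE permKV.
    by under eq_bigl do rewrite ltnW //.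
  split=> v; have := tot v; rewrite !natz; case: (v \in S) => //=; lia.
- have [f fE] := acyclic_topological_rank acyc.
  have [s sP] := sorting_perm f.
  (* The minus sign sorts the edges by decreasing rank of their tails. *)
  have [t tP] := sorting_perm (fun k : 'I_#|E| => - (f (enum_val k).1)%:Z).
  exists s, t; split=> [i j|i j|i].
  + rewrite mxE; case: (split_ordP j) => k ->; rewrite ?row_mxEl ?row_mxEr !mxE.
      by case: eqP.
    by do 2?case: ifP.
  + case: (split_ordP j) => k ->.
      under eq_bigr do rewrite mxE row_mxEl.
      rewrite (sum_perm_row s _ (unit_cols S ^~ k)).
      under eq_bigr do rewrite mxE.
      by rewrite sum_pred_eq; case: leqP.
    under eq_bigr do rewrite mxE row_mxEr mxE.
    rewrite (sum_perm_row s _ (incidence_mx E ^~ (t k))) sum_col_incidence_mx //=.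
    (* As the tail lies above the head, the partial sums down the column run through 0, 1, 0. *)
    have lt12 : ((s^-1)%g (enum_val (t k)).1 < (s^-1)%g (enum_val (t k)).2)%N.
      by apply: sP; rewrite !permKV; apply: fE; apply: enum_valP.
    case: (leqP ((s^-1)%g (enum_val (t k)).2) i) => [le2|_]; last by case: leqP.
    by rewrite (ltnW (leq_trans lt12 le2)).
  + apply: partial_sums_ge0.
      move=> k l; rewrite [row_perm _ _ _ k]mxE [row_perm _ _ _ l]mxE.
      (* A negative entry is never in the unit block, and a positive one there comes before all
         edges. Otherwise [s i] is the head of edge [t k'] and the tail of edge [t l'], so the
         latter has the higher-ranked tail and is listed earlier. *)
      case: (split_ordP k) => k' ->; first by rewrite row_mxEl mxE ltrn0.
      case: (split_ordP l) => l' ->; first by rewrite /= ltn_addr.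
      rewrite row_mxEr row_mxEr !mxE /= ltn_add2l.
      case: eqP => // _; case: eqP => // s2.
      case: eqP => [s1 _ _|_]; last by case: eqP.
      by apply: tP; rewrite ltrN2 ltz_nat -s1 s2; apply: fE; apply: enum_valP.
    under eq_bigr do rewrite mxE.
    rewrite sum_row_adjoin_units // !natz.
    have := deg_le (s i); have := degS (s i).
    case: (s i \in S) => /= [_|notS]; first by lia.
    (* Outside [S] the excess of indegree over outdegree is at most 1 and not 1, hence at most 0. *)
    by have : indeg E (s i) <> (outdeg E (s i) + 1)%N by [move/notS|]; lia.
Qed.
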